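(* Let $G$ be a finite-rank torsion-free abelian group. If $G$ is quasi-isomorphic to a stationary torsion-free abelian group, then $G$ is stationary.
   Context: The rank of a torsion-free abelian group is the size of any maximal linearly independent (over $\mathbb{Z}$) subset. A torsion-free abelian group is called stationary if it is isomorphic to the inductive limit $\varinjlim(\mathbb{Z}^r,A)$ of a sequence $\mathbb{Z}^r\xrightarrow{A}\mathbb{Z}^r\xrightarrow{A}\mathbb{Z}^r\xrightarrow{A}\cdots$ of finite-rank free abelian groups in which the homomorphism $A$ is the same at every stage. Finite-rank torsion-free abelian groups $G$ and $H$ are called quasi-isomorphic if there exist a positive integer $n$ and homomorphisms $\alpha:G\to H$ and $\beta:H\to G$ such that $\alpha\circ\beta=n\cdot\mathrm{id}_H$ and $\beta\circ\alpha=n\cdot\mathrm{id}_G$. *)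

(* Defs.v *)
From HB Require Import structures.
From mathcomp Require Import all_boot all_order all_algebra.
From mathcomp Require Import boolp classical_sets functions cardinality.
From mathcomp Require Import ring.

Set Implicit Arguments.
Unset Strict Implicit.
Unset Printing Implicit Defensive.

Import GRing.Theory.
Local Open Scope classical_set_scope.
Local Open Scope card_scope.
Local Open Scope quotient_scope.
Local Open Scope ring_scope.

Definition torsion_free (G : zmodType) : Prop :=
  forall (n : nat) (x : G), (0 < n)%N -> x *+ n = 0 -> x = 0.

Definition zindep (G : zmodType) (S : set G) : Prop :=
  forall (s : seq G) (c : G -> int), uniq s -> [set` s] `<=` S ->
    \sum_(x <- s) x *~ c x = 0 -> forall x, x \in s -> c x = 0.

Definition maximal_zindep (G : zmodType) (S : set G) : Prop :=
  zindep S /\ forall T : set G, zindep T -> S `<=` T -> T = S.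

Definition has_rank (G : zmodType) (r : nat) : Prop :=
  exists2 S : set G, maximal_zindep S & S #= `I_r.

Definition finite_rank (G : zmodType) : Prop := exists r : nat, has_rank G r.

Definition isomorphic (G H : zmodType) : Prop :=
  exists f : {additive G -> H}, bijective f.

Definition quasi_isomorphic (G H : zmodType) : Prop :=
  exists (n : nat) (alpha : {additive G -> H}) (beta : {additive H -> G}),
    [/\ (0 < n)%N, forall h, alpha (beta h) = h *+ n
      & forall g, beta (alpha g) = g *+ n].

(* The inductive limit of V -f-> V -f-> V -f-> ... is the disjoint union
   nat * V of the stages modulo "equal at some later stage", with the sum of
   two elements computed at a common stage. The lemmas dlim_inS, dlim_desc
   and dlim_desc_uniq are its universal property. *)
Section InductiveLimit.
Variables (V : zmodType) (f : {additive V -> V}).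
Implicit Types x y z : nat * V.

Definition dlim_rel x y : bool :=
  `[< exists k l : nat,
        (x.1 + k = y.1 + l)%N /\ iter k f x.2 = iter l f y.2 >].

Lemma dlim_rel_refl : reflexive dlim_rel.
Proof. by move=> x; apply/asboolP; exists 0%N, 0%N. Qed.

Lemma dlim_rel_sym : symmetric dlim_rel.
Proof.
by move=> x y; apply/asboolP/asboolP => -[k [l [e1 e2]]]; exists l, k.
Qed.

Lemma dlim_rel_trans : transitive dlim_rel.
Proof.
move=> y x z /asboolP[k [l [xy fxy]]] /asboolP[k' [l' [yz fyz]]].
apply/asboolP; exists (k + k')%N, (l + l')%N; split.
  by rewrite addnA xy addnAC yz addnAC -addnA.
by rewrite addnC iterD fxy -iterD addnC iterD fyz -iterD.
Qed.

Canonical dlim_equiv :=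
  EquivRel dlim_rel dlim_rel_refl dlim_rel_sym dlim_rel_trans.

Definition dlim : Type := {eq_quot dlim_rel}.
HB.instance Definition _ : EqQuotient _ dlim_rel dlim := EqQuotient.on dlim.
HB.instance Definition _ := Choice.on dlim.

Lemma dlim_eqP x y :
  \pi_dlim x = \pi_dlim y <->
  exists k l : nat, (x.1 + k = y.1 + l)%N /\ iter k f x.2 = iter l f y.2.
Proof.
split=> [/eqmodP/asboolP //|xy].
by apply/eqmodP/asboolP.
Qed.

Lemma iter_raddfD k : {morph iter k f : u v / u + v}.
Proof. by elim: k => // k IHk u v; rewrite !iterS IHk raddfD. Qed.

Lemma iter_raddf0 k : iter k f 0 = 0.
Proof. by elim: k => // k IHk; rewrite iterS IHk raddf0. Qed.

Lemma iter_raddfN k : {morph iter k f : u / - u}.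
Proof. by elim: k => // k IHk u; rewrite !iterS IHk raddfN. Qed.

Definition dlim_add_rep x y : nat * V :=
  ((x.1 + y.1)%N, iter y.1 f x.2 + iter x.1 f y.2).
Definition dlim_opp_rep x : nat * V := (x.1, - x.2).

Definition dlim_zero : dlim := \pi_dlim (0%N, 0).
Definition dlim_add (a b : dlim) : dlim :=
  \pi_dlim (dlim_add_rep (repr a) (repr b)).
Definition dlim_opp (a : dlim) : dlim := \pi_dlim (dlim_opp_rep (repr a)).

Lemma dlim_addE x y :
  dlim_add (\pi_dlim x) (\pi_dlim y) = \pi_dlim (dlim_add_rep x y).
Proof.
have /dlim_eqP[k [l [e fe]]] := reprK (\pi_dlim x).
have /dlim_eqP[k' [l' [e' fe']]] := reprK (\pi_dlim y).
rewrite /dlim_add; move: (repr (\pi_dlim x)) (repr (\pi_dlim y)) e fe e' fe'.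
move=> x' y' e fe e' fe'.
apply/dlim_eqP; exists (k + k')%N, (l + l')%N; split=> /=.
  by rewrite addnACA e e' addnACA.
rewrite !iter_raddfD -!iterD; congr (_ + _).
  have -> : (k + k' + y'.1 = y.1 + l' + k)%N by rewrite -e'; ring.
  by rewrite iterD fe -iterD; congr (iter _ f _); ring.
have -> : (k + k' + x'.1 = x.1 + l + k')%N by rewrite -e; ring.
by rewrite iterD fe' -iterD; congr (iter _ f _); ring.
Qed.

Lemma dlim_oppE x : dlim_opp (\pi_dlim x) = \pi_dlim (dlim_opp_rep x).
Proof.
have /dlim_eqP[k [l [e fe]]] := reprK (\pi_dlim x).
by apply/dlim_eqP; exists k, l; rewrite /= !iter_raddfN fe.
Qed.

Lemma dlim_addA : associative dlim_add.
Proof.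
elim/quotW=> x; elim/quotW=> y; elim/quotW=> z.
rewrite (dlim_addE y z) (dlim_addE x) (dlim_addE x y) (dlim_addE _ z).
congr (\pi_dlim _); rewrite /dlim_add_rep /= addnA !iter_raddfD -!iterD addrA.
by rewrite (addnC z.1 y.1) (addnC z.1 x.1).
Qed.

Lemma dlim_addC : commutative dlim_add.
Proof.
elim/quotW=> x; elim/quotW=> y.
rewrite (dlim_addE x y) (dlim_addE y x).
by rewrite /dlim_add_rep addnC addrC.
Qed.

Lemma dlim_add0 : left_id dlim_zero dlim_add.
Proof.
elim/quotW=> -[n x]; rewrite dlim_addE.
by rewrite /dlim_add_rep /= iter_raddf0 add0r.
Qed.

Lemma dlim_addN : left_inverse dlim_zero dlim_opp dlim_add.
Proof.
elim/quotW=> -[n x]; rewrite dlim_oppE dlim_addE /dlim_add_rep /=.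
rewrite -iter_raddfD addNr iter_raddf0.
by apply/dlim_eqP; exists 0%N, (n + n)%N; rewrite /= iter_raddf0 addn0.
Qed.

HB.instance Definition _ :=
  GRing.isZmodule.Build dlim dlim_addA dlim_addC dlim_add0 dlim_addN.

Definition dlim_in (n : nat) (v : V) : dlim := \pi_dlim (n, v).

Lemma dlim_in_is_zmod_morphism n : zmod_morphism (dlim_in n).
Proof.
move=> u v; rewrite /dlim_in.
have -> : \pi_dlim (n, u) - \pi_dlim (n, v) =
    dlim_add (\pi_dlim (n, u)) (dlim_opp (\pi_dlim (n, v))) by [].
rewrite dlim_oppE dlim_addE /dlim_add_rep /= -iter_raddfD.
by apply/dlim_eqP; exists n, 0%N; rewrite addn0.
Qed.

HB.instance Definition _ n :=
  GRing.isZmodMorphism.Build V dlim (dlim_in n) (dlim_in_is_zmod_morphism n).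

Lemma dlim_inS n v : dlim_in n.+1 (f v) = dlim_in n v.
Proof. by apply/dlim_eqP; exists 0%N, 1%N; rewrite addn0 addn1. Qed.

Lemma dlim_in_surj (a : dlim) : exists n v, a = dlim_in n v.
Proof. by elim/quotW: a => -[n v]; exists n, v. Qed.

Lemma dlim_in_eq0 n v : dlim_in n v = 0 <-> exists k : nat, iter k f v = 0.
Proof.
split=> [/dlim_eqP[k [l [_ e]]]|[k e]].
  by exists k; rewrite e iter_raddf0.
by apply/dlim_eqP; exists k, (n + k)%N; rewrite /= e iter_raddf0.
Qed.

Lemma dlim_desc (K : zmodType) (g : nat -> {additive V -> K}) :
  (forall n v, g n.+1 (f v) = g n v) ->
  exists u : {additive dlim -> K}, forall n v, u (dlim_in n v) = g n v.
Proof.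
move=> gS.
have gD n k v : g (n + k)%N (iter k f v) = g n v.
  by elim: k => [|k IHk]; rewrite ?addn0 // addnS iterS gS.
pose u (a : dlim) : K := g (repr a).1 (repr a).2.
have uE x : u (\pi_dlim x) = g x.1 x.2.
  have /dlim_eqP[k [l [e fe]]] := reprK (\pi_dlim x).
  by rewrite /u -(gD _ k) e fe gD.
have uD : zmod_morphism u.
  elim/quotW=> x; elim/quotW=> y.
  have -> : \pi_dlim x - \pi_dlim y =
    dlim_add (\pi_dlim x) (dlim_opp (\pi_dlim y)) by [].
  rewrite dlim_oppE dlim_addE !uE /= raddfD iter_raddfN raddfN.
  by rewrite gD addnC gD.
pose U := GRing.isZmodMorphism.Build dlim K u uD.
pose h : {additive dlim -> K} := HB.pack u U.
by exists h => n v; rewrite /= uE.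
Qed.

Lemma dlim_desc_uniq (K : zmodType) (u w : {additive dlim -> K}) :
  (forall n v, u (dlim_in n v) = w (dlim_in n v)) -> u =1 w.
Proof. by move=> uw a; have [n [v ->]] := dlim_in_surj a; apply: uw. Qed.

End InductiveLimit.

Definition stationary (G : zmodType) : Prop :=
  torsion_free G /\
  exists (r : nat) (A : {additive 'rV[int]_r -> 'rV[int]_r}),
    isomorphic G (dlim A).

(* Main.v *)
Require Import Defs.
From mathcomp Require Import all_boot all_order all_algebra.
From HB Require Import structures.
From mathcomp Require Import boolp.

(** Write H as the limit of A acting on Z^r, and let n, alpha, beta witness
    that G and H are quasi-isomorphic. Since G is torsion-free, alpha is
    injective, so G may be identified with its image K, and n H <= K <= H.

    The endomorphisms of Z^r / n Z^r form a finite set, so the powers of A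
    repeat modulo n: A^(a + m) = A^a modulo n with 0 < m
    ([iter_mod_periodic]). As A becomes invertible in the limit, the factor
    A^a can be cancelled there: A^(mj) v and v have the same image modulo n H
    at every stage, for all j ([dlim_in_iter_mod]). Hence, for a vector v,
    whether its image at stage mj lies in K does not depend on j. The vectors
    for which it does form a subgroup M of Z^r stable under A^m, and K is the
    limit of A^m acting on M: every element of H comes from a stage that is a
    multiple of m. Finally M is a subgroup of Z^r, hence isomorphic to some
    Z^s ([subgroup_rV_int_free]), and A^m on M becomes an endomorphism of
    Z^s. *)

Set Implicit Arguments.
Unset Strict Implicit.
Unset Printing Implicit Defensive.

Import GRing.Theory Num.Theory.
Local Open Scope ring_scope.

Lemma raddf_inj0 (U V : zmodType) (f : {additive U -> V}) :
  (forall x, f x = 0 -> x = 0) -> injective f.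
Proof.
move=> f0 x y fxy; apply/eqP; rewrite -subr_eq0; apply/eqP/f0.
by rewrite raddfB fxy subrr.
Qed.

(** The set-theoretic lift is additive because it is unique. Applied to the
    identity it inverts bijective morphisms; applied to the inclusion of a
    subgroup it restricts morphisms. *)
Lemma additive_lift (U V W : zmodType) (f : {additive U -> W})
    (g : {additive V -> W}) :
  injective f -> (forall v, exists u, f u = g v) ->
  exists h : {additive V -> U}, forall v, f (h v) = g v.
Proof.
move=> injf /choice[h hE].
have hB : zmod_morphism h by move=> x y; apply: injf; rewrite raddfB !hE raddfB.
pose hM := GRing.isZmodMorphism.Build V U h hB.
by exists (HB.pack h hM : {additive V -> U}).
Qed.

Lemma iter_is_zmod_morphism (V : zmodType) (f : {additive V -> V}) k :
  zmod_morphism (iter k f).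
Proof. by move=> x y; rewrite iter_raddfD iter_raddfN. Qed.

HB.instance Definition _ (V : zmodType) (f : {additive V -> V}) k :=
  GRing.isZmodMorphism.Build V V (iter k f) (iter_is_zmod_morphism f k).

Lemma dlim_in_iter (V : zmodType) (f : {additive V -> V}) j k v :
  dlim_in f (j + k) (iter k f v) = dlim_in f j v.
Proof. by elim: k => [|k IHk]; rewrite ?addn0 // addnS iterS dlim_inS. Qed.

(** * Subgroups of Z^r *)

Lemma subgroup_closedMz (V : zmodType) (P : V -> Prop) :
  P 0 -> (forall x y, P x -> P y -> P (x - y)) ->
  forall x (q : int), P x -> P (x *~ q).
Proof.
move=> P0 PB x q Px.
have PN y : P y -> P (- y) by rewrite -[- y]sub0r; apply: PB.
have PMn k : P (x *+ k).
  elim: k => // k IHk; rewrite mulrS -[x *+ k]opprK.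
  by apply: PB => //; apply: PN.
by case: q => k; [exact: PMn | exact/PN/PMn].
Qed.

(** Division with remainder: a nonzero element of least absolute value
    divides all the others. *)
Lemma subgroup_int_principal (P : int -> Prop) :
  P 0 -> (forall x y, P x -> P y -> P (x - y)) ->
  exists2 d, P d & forall x, P x -> exists q, x = q * d.
Proof.
move=> P0 PB.
have PN x : P x -> P (- x) by rewrite -[- x]sub0r; apply: PB.
have PM (q d : int) : P d -> P (q * d).
  by move=> Pd; rewrite mulrC -mulrzz; apply: subgroup_closedMz.
have [[x [Px x0]]|noP] := pselect (exists x, P x /\ x != 0); last first.
  exists 0 => // x Px; exists 0; rewrite mul0r.
  by apply/eqP/negPn/negP => x0; apply: noP; exists x.
have exQ : exists k : nat, `[< (0 < k)%N /\ P k%:Z >].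
  exists `|x|%N; apply/asboolP; split; first by rewrite absz_gt0.
  by rewrite abszE; have [_|_] := ger0P x => //; apply: PN.
case: (ex_minnP exQ) => d /asboolP[d0 Pd] dmin.
exists d%:Z => // y Py; exists (y %/ d%:Z)%Z.
have Pr : P (y %% d%:Z)%Z by rewrite /modz; apply: PB => //; apply: PM.
rewrite {1}(divz_eq y d%:Z).
have r0 : (0 <= (y %% d%:Z)%Z) by apply: modz_ge0; rewrite -lt0n.
have : (y %% d%:Z)%Z < d%:Z by apply: ltz_pmod.
case: (y %% d%:Z)%Z r0 Pr => // k _ Pk; rewrite ltz_nat.
case: (posnP k) => [->|k0]; first by rewrite addr0.
by rewrite ltnNge dmin //; apply/asboolP.
Qed.

(** Induction on r along the first coordinate: the first coordinates of
    elements of P form a principal subgroup d Z, and P is generated by an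
    element v0 of first coordinate d together with the elements of first
    coordinate 0. No v0 is added when d = 0, as it would not be independent of
    the rest. *)
Lemma subgroup_rV_int_free r (P : 'rV[int]_r -> Prop) :
  P 0 -> (forall x y, P x -> P y -> P (x - y)) ->
  exists s (f : {additive 'rV[int]_s -> 'rV[int]_r}),
    injective f /\ forall v, P v <-> exists u, f u = v.
Proof.
elim: r P => [|r IHr] P P0 PB.
  exists 0%N, (idfun : {additive 'rV[int]_0 -> 'rV[int]_0}); split => // v.
  by rewrite [v]thinmx0; split=> // _; exists 0.
pose lin0 (w : 'rV[int]_r) : 'rV[int]_(1 + r) := row_mx 0 w.
have lin0B x y : lin0 (x - y) = lin0 x - lin0 y.
  by rewrite /lin0 opp_row_mx add_row_mx subrr.
have [||s [f [injf fP]]] := IHr (fun w => P (lin0 w)).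
- by rewrite /lin0 row_mx0.
- by move=> x y Px Py; rewrite lin0B; apply: PB.
have lin0_inj : injective lin0 by move=> x y /eq_row_mx[].
have [||d [v0 Pv0 v0d] dP] :=
  @subgroup_int_principal (fun x => exists2 v : 'rV_(1 + r), P v & v 0 0 = x).
- by exists 0 => //; rewrite mxE.
- by move=> _ _ [x Px <-] [y Py <-]; exists (x - y); [exact: PB | rewrite !mxE].
have lin0E (v : 'rV[int]_(1 + r)) : v 0 0 = 0 -> v = lin0 (rsubmx v).
  move=> v00; rewrite -{1}[v]hsubmxK /lin0; congr row_mx.
  apply/rowP => i; rewrite !mxE !ord1 -[RHS]v00; congr (v _ _); exact: val_inj.
have lin000 w : lin0 w 0 0 = 0.
  have -> : 0 = lshift r (0 : 'I_1) :> 'I_(1 + r) by apply: val_inj.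
  by rewrite row_mxEl mxE.
have PN x : P x -> P (- x) by rewrite -[- x]sub0r; apply: PB.
have PZ (q : int) v : P v -> P (q *: v).
  by move=> Pv; rewrite -[q]intz scaler_int; apply: subgroup_closedMz.
have [d0|d0] := eqVneq d 0.
  have gB : zmod_morphism (fun u => lin0 (f u)).
    by move=> x y; rewrite raddfB lin0B.
  pose gM := GRing.isZmodMorphism.Build _ _ _ gB.
  exists s, (HB.pack (fun u => lin0 (f u)) gM : {additive _ -> _}).
  split=> [x y /lin0_inj/injf //|v]; split=> /= [Pv|[u <-]]; last first.
    by apply/(fP (f u)); exists u.
  have v00 : v 0 0 = 0.
    have [|q ->] := dP (v 0 0); first by exists v.
    by rewrite d0 mulr0.
  have /fP[u uE] : P (lin0 (rsubmx (v : 'rV_(1 + r)))) by rewrite -lin0E.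
  by exists u; rewrite uE -lin0E.
pose g (u : 'rV[int]_(1 + s)) := u 0 0 *: v0 + lin0 (f (rsubmx u)).
have gB : zmod_morphism g.
  move=> x y; rewrite /g !mxE raddfB /= raddfB lin0B scalerBl /=.
  by rewrite addrACA -opprD.
pose gM := GRing.isZmodMorphism.Build _ _ _ gB.
exists (1 + s)%N, (HB.pack g gM : {additive _ -> _}).
have g00 u : (g u) 0 0 = u 0 0 * d by rewrite /g mxE lin000 addr0 mxE v0d.
split=> [|v]; last split=> /= [Pv|[u <-]].
- apply: raddf_inj0 => u /= gu.
  have u0 : u 0 0 = 0.
    apply/eqP; have := g00 u; rewrite gu mxE => /esym/eqP.
    by rewrite mulf_eq0 (negPf d0) orbF.
  move: gu; rewrite /g u0 scale0r add0r.
  have -> : (0 : 'rV[int]_r.+1) = lin0 (f 0) by rewrite raddf0 /lin0 row_mx0.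
  move=> /lin0_inj/injf ur.
  rewrite -[u]hsubmxK ur; apply/rowP => i; rewrite !mxE.
  case: splitP => j _; rewrite !mxE // ord1 -[RHS]u0.
  by congr (u _ _); apply: val_inj.
- have [|q vq] := dP (v 0 0); first by exists v.
  have vv0 : (v - q *: v0) 0 0 = 0 by rewrite !mxE v0d vq subrr.
  have /fP[u uE] : P (lin0 (rsubmx (v - q *: v0 : 'rV_(1 + r)))).
    by rewrite -lin0E //; apply: PB => //; apply: PZ.
  exists (row_mx q%:M u); rewrite /g row_mxKr uE -lin0E //.
  have -> : 0 = lshift s (0 : 'I_1) :> 'I_(1 + s) by apply: val_inj.
  by rewrite row_mxEl mxE mulr1n addrC subrK.
- rewrite /g -[lin0 _]opprK; apply: PB; first exact: PZ.
  by apply: PN; apply/(fP (f _)); exists (rsubmx u).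
Qed.

(** * Periodicity modulo n *)

(** Pigeonhole on the matrices modulo n of the iterates of A. *)
Lemma iter_mod_periodic r (A : {additive 'rV[int]_r -> 'rV[int]_r}) n :
  (0 < n)%N ->
  exists a m, (0 < m)%N /\
    forall v, exists w, iter (a + m) A v - iter a A v = w *+ n.
Proof.
case: n => // n _.
pose D (k : nat) : 'M['I_n.+1]_r :=
  \matrix_(i, j) inord `|(iter k A (delta_mx ord0 i) ord0 j %% n.+1%:Z)%Z|.
have [k [l [kl Dkl]]] : exists k l, (k < l)%N /\ D k = D l.
  pose N := #|{: 'M['I_n.+1]_r}|.
  have : ~~ injectiveb (fun k : 'I_N.+1 => D k).
    apply/negP => /injectiveP/leq_card; by rewrite card_ord ltnn.
  case/injectivePn => k [l kl Dkl].
  by case: (ltngtP k l) => [ltkl|ltkl|/val_inj klE];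
    [exists k, l | exists l, k | rewrite klE eqxx in kl].
exists k, (l - k)%N; split; first by rewrite subn_gt0.
rewrite subnKC 1?ltnW // => v.
have base i :
    exists w, iter l A (delta_mx 0 i) - iter k A (delta_mx 0 i) = w *+ n.+1.
  pose d := iter l A (delta_mx ord0 i) - iter k A (delta_mx ord0 i).
  exists (\row_j (d ord0 j %/ n.+1%:Z)%Z).
  apply/rowP => j; rewrite mulmxnE [in RHS]mxE -mulr_natr natz divzK //.
  rewrite !mxE -eqz_mod_dvd; have /matrixP/(_ i j) := Dkl.
  rewrite !mxE => /(congr1 val).
  have lt x : (`|(x %% n.+1%:Z)%Z| < n.+1)%N.
    by rewrite -ltz_nat gez0_abs ?modz_ge0 // ltz_pmod.
  rewrite /= !inordK // => /(congr1 Posz).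
  by rewrite !gez0_abs ?modz_ge0 // => ->.
have [w wE] := choice base.
exists (\sum_i v 0 i *: w i); rewrite {1 2}[v]row_sum_delta.
rewrite !raddf_sum -big_split -sumrMnl /=; apply: eq_bigr => i _.
by rewrite -[v 0 i]intz !scaler_int !raddfMz /= -mulrzDl wE !pmulrn mulrzAC.
Qed.

(** * Subgroups of the limit *)

(** In the limit, A^a can be undone by moving a stages up. *)
Lemma dlim_in_iter_mod (V : zmodType) (A : {additive V -> V}) n a m :
  (forall v, exists w, iter (a + m) A v - iter a A v = w *+ n) ->
  forall i j v, exists h,
    dlim_in A i (iter (m * j) A v) - dlim_in A i v = h *+ n.
Proof.
move=> am i j v; elim: j => [|j [h hE]].
  by exists 0; rewrite muln0 subrr mul0rn.
have [w wE] := am (iter (m * j) A v).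
exists (h + dlim_in A (i + a) w).
rewrite mulrnDl -hE -raddfMn -wE raddfB /= iterD !dlim_in_iter mulnS iterD.
by rewrite [RHS]addrC subrKA.
Qed.

Theorem theorem5p7 (G : zmodType) (tfG : torsion_free G) (frG : finite_rank G)
    (H : zmodType) (stH : stationary H) (qGH : quasi_isomorphic G H) :
  stationary G.
Proof.
split=> //.
case: stH => _ [r [A [phi [psi phiK psiK]]]].
case: qGH => n [alpha [beta [n0 abE baE]]].
pose al : {additive G -> dlim A} := phi \o alpha.
have al_inj : injective al.
  apply: raddf_inj0 => x al0; apply: (tfG n) => //.
  by rewrite -baE -(phiK (alpha x)) [phi _]al0 -(raddf0 phi) phiK raddf0.
have al_n h : exists g, al g = h *+ n.
  by exists (beta (psi h)); rewrite /= abE raddfMn psiK.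
have [a [m [m0 am]]] := iter_mod_periodic A n0.
(* Membership in the image of G, tested at stage m j; it does not depend on
   j by M_stage. *)
pose M j v := exists g, al g = dlim_in A (m * j) v.
have M0 j : M j 0 by exists 0; rewrite !raddf0.
have MB j x y : M j x -> M j y -> M j (x - y).
  by move=> [g gE] [h hE]; exists (g - h); rewrite !raddfB gE hE.
have M_iter j k v : M j (iter (m * k) A v) <-> M j v.
  have [h hE] := dlim_in_iter_mod am (m * j) k v.
  have [g gE] := al_n h.
  split=> -[g' g'E]; [exists (g' - g) | exists (g' + g)].
    by rewrite raddfB g'E gE -hE subKr.
  by rewrite raddfD g'E gE -hE addrC subrK.
have M_stage j v : M j v <-> M 0%N v.
  (* v at stage 0 is A^(mj) v at stage m j. *)
  have -> : M 0%N v = M j (iter (m * j) A v).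
    by rewrite /M muln0 -(dlim_in_iter A 0 (m * j) v) add0n.
  by rewrite M_iter.
have [s [f [injf fM]]] := subgroup_rV_int_free (M0 0%N) (MB 0%N).
have Mf u : M 0%N (f u) by apply/fM; exists u.
have [B BE] : exists B : {additive 'rV[int]_s -> 'rV[int]_s},
    forall u, f (B u) = iter m A (f u).
  apply: (additive_lift (g := iter m A \o f)) => // u; apply/fM.
  by rewrite /= -[m]muln1; apply/M_iter.
have [g gE] : exists g : nat -> {additive 'rV[int]_s -> G},
    forall j u, al (g j u) = dlim_in A (m * j) (f u).
  suff /choice[g gE] j : exists g : {additive 'rV[int]_s -> G},
      forall u, al (g u) = dlim_in A (m * j) (f u) by exists g.
  apply: (additive_lift (g := dlim_in A (m * j) \o f)) => // u.
  exact/M_stage.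
have [|w wE] := @dlim_desc _ B G g.
  by move=> j u; apply: al_inj; rewrite !gE BE mulnS addnC dlim_in_iter.
have w_inj : injective w.
  apply: raddf_inj0 => x; have [j [u ->]] := dlim_in_surj x.
  rewrite wE => /(congr1 al); rewrite gE raddf0 => /dlim_in_eq0[k Ak].
  apply/dlim_in_eq0; exists k; apply: injf; rewrite raddf0.
  have -> : f (iter k B u) = iter (m * k) A (f u).
    elim: k {Ak} => [|k IHk]; first by rewrite muln0.
    by rewrite iterS BE IHk -iterD mulnS.
  by rewrite -(subnK (leq_pmull k m0)) iterD Ak raddf0.
(* An element of stage k also lives at stage m k >= k. *)
have w_surj x : exists y, w y = x.
  have [k [v xE]] := dlim_in_surj (al x).
  have xE' : al x = dlim_in A (m * k) (iter (m * k - k) A v).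
    by rewrite xE -{1}(subnKC (leq_pmull k m0)) dlim_in_iter.
  have /fM[u uE] : M 0%N (iter (m * k - k) A v).
    by apply/(M_stage k); exists x.
  by exists (dlim_in B k u); apply: al_inj; rewrite wE gE uE xE'.
have [h hE] := additive_lift (g := (idfun : {additive G -> G})) w_inj w_surj.
exists s, B, h; exists w => // x.
by apply: w_inj; rewrite hE.
Qed.
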